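(* The operators $\tilde D_x,\tilde D^x_x:\mathbb R^{N_xK}\to\mathbb R^{N_xK-1}$ have kernels of dimension one. The kernel of $\tilde D_x$ is generated by a function that is discontinuous at each (interior) cell interface, while the kernel of $\tilde D^x_x$ is generated by the constant function $1$.
   Context: Let $K\ge1$, and let $\Omega^x=\bigcup_{i=0}^{N_x-1}E_i$ be an interval divided into $N_x$ cells $E_i=[x_i,x_{i+1}]$ of equal length $\Delta x$. Let $V^{K}_{\Delta x,0}$ be the space of continuous functions on $\Omega^x$ that are polynomials of degree $\le K$ on each cell and vanish at both endpoints of $\Omega^x$ (dimension $N_xK-1$), and let $V^{K-1}_{\Delta x,b}$ be the space of functions in $L^2(\Omega^x)$ that are polynomials of degree $\le K-1$ on each cell, with no continuity required (dimension $N_xK$). For $z_h\in V^{K-1}_{\Delta x,b}$, $\tilde D_xz$ is the linear functional $\varphi\mapsto\int_{\Omega^x}\varphi\,z_h\,dx$ on $V^K_{\Delta x,0}$, and $\tilde D^x_xz$ is the linear functional $\varphi\mapsto\int_{\Omega^x}\partial_x\varphi\,z_h\,dx$ on $V^K_{\Delta x,0}$; expressed in bases they are linear maps $\mathbb R^{N_xK}\to\mathbb R^{N_xK-1}$. *)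

(* Defs.v *)
From HB Require Import structures.
From mathcomp Require Import all_boot all_order all_algebra.
From mathcomp Require Import all_classical all_reals all_analysis.
Set Implicit Arguments.
Unset Strict Implicit.
Unset Printing Implicit Defensive.
Import Order.TTheory GRing.Theory Num.Theory.
Import numFieldNormedType.Exports.
Local Open Scope classical_set_scope.
Local Open Scope ring_scope.

Section PiecewisePolynomials.
Variables (R : realType) (a dx : R) (N : nat).

Definition node (i : nat) : R := a + i%:R * dx.

Definition Omega : set R := `[node 0, node N].

(* All functions are total on R, but only their values on Omega matter. *)
Definition eq_on_Omega (f g : R -> R) : Prop :=
  forall x, Omega x -> f x = g x.

Definition ae_eq_on_Omega (f g : R -> R) : Prop :=
  ae_eq (@lebesgue_measure R) Omega f g.

Definition V0 (K : nat) : set (R -> R) := [set f |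
  [/\ {within Omega, continuous f},
      forall i : nat, (i < N)%N -> exists2 p : {poly R}, (size p <= K.+1)%N &
        forall x, x \in `[node i, node i.+1] -> f x = p.[x],
      f (node 0) = 0 &
      f (node N) = 0]].

(* Representatives of the elements of L^2(Omega) that are polynomials of degree
   at most K.-1 (for 0 < K) on each cell; the values at the nodes, a null set,
   are arbitrary, and representatives are identified by ae_eq_on_Omega. *)
Definition Vb (K : nat) : set (R -> R) := [set f |
  forall i : nat, (i < N)%N -> exists2 p : {poly R}, (size p <= K)%N &
    forall x, x \in `]node i, node i.+1[ -> f x = p.[x]].

Definition is_basis (eqv : (R -> R) -> (R -> R) -> Prop) (V : set (R -> R))
    (n : nat) (e : 'I_n -> R -> R) : Prop :=
  (forall j, V (e j)) /\
  (forall f, V f ->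
     exists! c : 'rV[R]_n, eqv f (fun x => \sum_(j < n) c ord0 j * e j x)).

Definition Dx (z phi : R -> R) : R :=
  \int[@lebesgue_measure R]_(x in Omega) (phi x * z x).

(* At the nodes, a null set, derive1 phi takes an irrelevant value when phi is not
   differentiable there. *)
Definition Dxx (z phi : R -> R) : R :=
  \int[@lebesgue_measure R]_(x in Omega) (derive1 phi x * z x).

(* The matrix acts on row vectors of coordinates, c |-> c *m opmx D psi phi. *)
Definition opmx (D : (R -> R) -> (R -> R) -> R) (n m : nat)
    (psi : 'I_n -> R -> R) (phi : 'I_m -> R -> R) : 'M[R]_(n, m) :=
  \matrix_(j, i) D (psi j) (phi i).

Definition opker (K : nat) (D : (R -> R) -> (R -> R) -> R) : set (R -> R) :=
  [set z | Vb K z /\ forall phi, V0 K phi -> D z phi = 0].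

Definition generated_by (S : set (R -> R)) (z : R -> R) : Prop :=
  S z /\ forall w, S w -> exists c : R, ae_eq_on_Omega w (fun x => c * z x).

(* Discontinuity of the a.e. class of z: no representative is continuous at x. *)
Definition ae_discontinuous_at (z : R -> R) (x : R) : Prop :=
  forall g : R -> R, ae_eq_on_Omega z g -> ~ {for x, continuous g}.

End PiecewisePolynomials.

(* Main.v *)
Require Import Defs.
From HB Require Import structures.
From mathcomp Require Import all_boot all_order all_algebra.
From mathcomp Require Import all_classical all_reals all_analysis.
From mathcomp Require Import measurable_realfun zify ring lra.
Set Implicit Arguments.
Unset Strict Implicit.
Unset Printing Implicit Defensive.
Import Order.TTheory GRing.Theory Num.Theory.
Import numFieldNormedType.Exports.
Local Open Scope classical_set_scope.
Local Open Scope ring_scope.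

(** Everything is reduced to polynomials. Let z be in the discontinuous space
    and phi in the conforming one, with cell polynomials p i and q i: both
    pairings are then finite sums of integrals of polynomials over the cells
    (lemmas [Dx_pieces] and [Dxx_pieces]), and almost everywhere equality means
    equality of the cell polynomials ([ae_eq_piecesP]). Conversely, polynomials
    that match at the interior nodes and vanish at both ends of the interval
    can be glued into an element of the conforming space ([conforming_V0]). So
    z is in the kernel if and only if p annihilates all conforming families,
    and in each kernel the elements are found by testing p against a family
    built from p itself, so that the pairing becomes a sum of integrals of
    nonnegative polynomials.

    For the derivative pairing, p is tested against the primitive of z - c that
    vanishes at the left end, where c is the mean of z; it also vanishes at the
    right end, precisely because c is the mean. As constants are in the kernel
    by telescoping, the pairing is the integral of (z - c)^2, whence z = c
    ([annihilates_deriv_eq_cst]).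

    For the mass pairing, the test functions are z times piecewise linear hat
    functions. If z is continuous at an interior node, its product with the hat
    function of that node is conforming, and z must vanish on both adjacent
    cells. If z vanishes on one cell, the same test with the vanishing
    factor replaced by a constant shows that it vanishes on the neighbouring
    cells, hence everywhere. If the trace of z at the left end of the interval
    is 0, then z times the half-hat on the first cell is conforming, and z
    vanishes on that cell, hence everywhere. The last fact bounds the dimension
    of the kernel by 1, because a suitable combination of two elements has zero
    left trace ([Dx_kernel_generated]), and the first two show that a nonzero
    element is discontinuous at every interior node
    ([Dx_kernel_discontinuous]). A nonzero element exists because the matrix
    has fewer columns than rows ([opker_neq0]).

    Finally, a row vector is in the kernel of the matrix if and only if the
    corresponding combination of basis functions is in the kernel of the
    operator ([kermx_opker]), which turns a single generator into rank 1
    ([generated_rank1]). *)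

(** * Integrals of polynomials over an interval *)

Section PolynomialIntegral.
Variable R : realType.
Implicit Types (l r x : R) (p q : {poly R}).

(** The primitive without constant term: that coefficient is divided by 0%:R,
    hence is 0. *)
Definition antideriv p : {poly R} :=
  \poly_(i < (size p).+1) (p`_i.-1 / i%:R).

Lemma coef_antideriv p i : (antideriv p)`_i = p`_i.-1 / i%:R.
Proof.
rewrite coef_poly; case: ltnP => // pi.
by rewrite nth_default ?mul0r// -ltnS prednK// (leq_ltn_trans _ pi).
Qed.

Lemma antideriv_is_linear : linear antideriv.
Proof.
move=> c p q; apply/polyP => i.
by rewrite coefD coefZ !coef_antideriv coefD coefZ mulrDl mulrA.
Qed.

HB.instance Definition _ :=
  GRing.isLinear.Build R {poly R} {poly R} _ antideriv antideriv_is_linear.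

Lemma deriv_antideriv p : (antideriv p)^`() = p.
Proof.
apply/polyP => i; rewrite coef_deriv coef_antideriv /= -[LHS]mulr_natr.
by rewrite divfK// pnatr_eq0.
Qed.

Lemma size_antideriv p : (size (antideriv p) <= (size p).+1)%N.
Proof. exact: size_poly. Qed.

(** The integral of p from l to r, kept algebraic so that linearity and
    positivity need no integrability side conditions. *)
Definition pint l r p : R := (antideriv p).[r] - (antideriv p).[l].

Lemma pint_is_linear l r : linear_for *%R (pint l r).
Proof. by move=> c p q; rewrite /pint linearP !hornerE/=; ring. Qed.

HB.instance Definition _ l r :=
  GRing.isLinear.Build R {poly R} R *%R (pint l r) (pint_is_linear l r).

Lemma deriv0_horner p x y : p^`() = 0 -> p.[x] = p.[y].
Proof.
move=> p'0; suff -> : p = (p`_0)%:P by rewrite !hornerC.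
apply/polyP => -[|i]; rewrite coefC//=.
have /eqP := congr1 (fun q : {poly R} => q`_i) p'0.
by rewrite coef_deriv coef0 mulrn_eq0 => /eqP.
Qed.

Lemma pint_deriv l r p : pint l r p^`() = p.[r] - p.[l].
Proof.
have : (antideriv p^`() - p)^`() = 0 by rewrite derivB deriv_antideriv subrr.
move/(@deriv0_horner _ l r); rewrite /pint !hornerE/= => H; lra.
Qed.

(** The interval provides more roots than the degree of p allows. *)
Lemma poly_itv0 l r p :
  l < r -> (forall x, l < x < r -> p.[x] = 0) -> p = 0.
Proof.
move=> lr p0; apply/eqP/negPn/negP => pN0.
(* The points l + (r - l) / (i + 2) are distinct and interior. *)
pose rs := [seq l + (r - l) / i.+2%:R | i <- iota 0 (size p)].
have /(max_poly_roots pN0) : all (root p) rs.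
  apply/allP => _ /mapP[i _ ->]; apply/eqP/p0.
  have i2 : 0 < i.+2%:R :> R by rewrite ltr0n.
  rewrite ltrDl divr_gt0 ?subr_gt0//=.
  rewrite -ltrBrDl ltr_pdivrMr// ltr_pMr ?subr_gt0//.
  by rewrite ltr1n.
suff urs : uniq rs by move=> /(_ urs); rewrite size_map size_iota ltnn.
rewrite map_inj_uniq ?iota_uniq// => i j /addrI/mulfI.
rewrite gt_eqF ?subr_gt0// => /(_ erefl)/invr_inj/eqP.
by rewrite eqr_nat => /eqP[].
Qed.

Lemma antideriv_mono l r p : (forall x, l < x < r -> 0 <= p.[x]) ->
  {in `[l, r] &, {homo horner (antideriv p) : x y / x <= y}}.
Proof.
move=> p0; apply: ger0_derive1_le_cc.
- by move=> x _; exact: derivable_horner.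
- by move=> x xlr; rewrite -derivE deriv_antideriv p0// -in_itv.
- exact/continuous_subspaceT/continuous_horner.
Qed.

Lemma pint_ge0 l r p :
  l <= r -> (forall x, l < x < r -> 0 <= p.[x]) -> 0 <= pint l r p.
Proof.
move=> lr p0; rewrite subr_ge0 (antideriv_mono p0)//.
  by rewrite in_itv/= lexx lr.
by rewrite in_itv/= lexx lr.
Qed.

(** The primitive is nondecreasing with equal end values, hence constant on
    the interval; being a polynomial, it is constant. *)
Lemma pint_eq0 l r p : l < r -> (forall x, l < x < r -> 0 <= p.[x]) ->
  pint l r p = 0 -> p = 0.
Proof.
move=> lr p0 /subr0_eq Plr; have mono := antideriv_mono p0.
suff : antideriv p - ((antideriv p).[l])%:P = 0.
  move/(congr1 (@deriv _)).
  by rewrite derivB derivC deriv_antideriv subr0 linear0.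
apply: (poly_itv0 lr) => x /andP[lx xr]; rewrite !hornerE; apply/eqP.
rewrite subr_eq0 eq_le -{1}Plr.
by rewrite !mono ?in_itv//= ?lexx ?(ltW lx) ?(ltW xr) ?(ltW lr).
Qed.

(** The half-open interval is chosen because such cells tile the domain
    without overlap. *)
Lemma integral_poly_itv l r p (f : R -> R) : l < r ->
    (forall x, x \in `]l, r[ -> f x = p.[x]) ->
  measurable_fun `[l, r[ f /\
  (\int[@lebesgue_measure R]_(x in `[l, r[) (f x)%:E = (pint l r p)%:E)%E.
Proof.
move=> lr fp.
have mp : measurable_fun `]l, r[ (horner p).
  exact: measurable_poly.
have mf : measurable_fun `]l, r[ f.
  by apply: eq_measurable_fun mp => x; rewrite inE => /fp.
split; first exact/measurable_fun_itv_obnd_cbndP.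
rewrite -integral_itv_obnd_cbnd; last exact/measurable_EFinP.
transitivity (\int[@lebesgue_measure R]_(x in `]l, r[) (p.[x])%:E)%E.
  by apply: eq_integral => x; rewrite inE => /fp ->.
rewrite integral_itv_obnd_cbnd; last exact/measurable_EFinP.
rewrite integral_itv_bndo_bndc; last first.
  by apply/measurable_EFinP/measurable_fun_itv_obnd_cbndP.
rewrite (@continuous_FTC2 _ _ (horner (antideriv p)))//.
- exact/continuous_subspaceT/continuous_horner.
- split; first by move=> x _; exact: derivable_horner.
  + by apply: cvg_at_right_filter; exact: continuous_horner.
  + by apply: cvg_at_left_filter; exact: continuous_horner.
- by move=> x _; rewrite -derivE deriv_antideriv.
Qed.

End PolynomialIntegral.

(** * Almost everywhere equality near a point *)

Section AlmostEverywhere.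
Variable R : realType.
Implicit Types (l r x : R) (p q : {poly R}).

(** A nonempty open interval has positive measure, so it is not negligible. *)
Lemma ae_itv_ex l r (P : R -> Prop) : l < r ->
  {ae @lebesgue_measure R, forall x, P x} -> exists x, l < x < r /\ P x.
Proof.
move=> lr aeP; apply: contrapT => nP.
have : (@lebesgue_measure R).-negligible `]l, r[.
  apply: negligibleS aeP => x /=; rewrite in_itv/= => xlr Px.
  by apply: nP; exists x.
move/negligibleP => /(_ (measurable_itv _)) /eqP.
rewrite -[X in X == _]/(lebesgue_measure `]l, r[%classic).
rewrite lebesgue_measure_itv/=.
by rewrite lte_fin lr -EFinB eqe subr_eq0 gt_eqF.
Qed.

(** An almost everywhere equality extends to the end points of the interval by
    one-sided continuity: otherwise g and p would differ on a whole
    neighbourhood of x, which meets the interval in an open interval. This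
    both recovers cell polynomials from an almost everywhere class and gives
    the one-sided traces at a node of a continuous representative. *)
Lemma ae_eq_poly_cont l r x p (g : R -> R) : l < r -> x \in `[l, r] ->
  {ae @lebesgue_measure R, forall y, l < y < r -> g y = p.[y]} ->
  {for x, continuous g} -> g x = p.[x].
Proof.
move=> lr xlr gp cg; apply/eqP/negPn/negP => gpx.
have ch : {for x, continuous (fun y => g y - p.[y])}.
  by apply: cvgB; [exact: cg|exact: continuous_horner].
have [e /= e0 eh] : \forall y \near x, g y - p.[y] != 0.
  have := ch; rewrite /continuous_at => /(_ [set z | z != 0]); apply.
  apply: open_nbhs_nbhs; split; first exact: open_neq.
  by rewrite /= subr_eq0.
have : Num.max l (x - e) < Num.min r (x + e).
  move: xlr; rewrite in_itv/= => /andP[lx xr].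
  by rewrite gt_max !lt_min lr/=; apply/and3P; split; lra.
move/ae_itv_ex => /(_ _ gp)[y []]; rewrite gt_max lt_min.
move=> /andP[/andP[ly xey] /andP[yr yxe]] gy.
have /eh : ball x e y by rewrite /ball/= ltr_distlC xey yxe.
by rewrite gy ?ly// subrr eqxx.
Qed.

End AlmostEverywhere.

(** * Piecewise polynomials and their cell polynomials *)

Section Pieces.
Variables (R : realType) (a dx : R) (N : nat).
Hypothesis dx_gt0 : 0 < dx.
Local Notation node := (node a dx).
Local Notation Omega := (Omega a dx N).
Implicit Types (f g z : R -> R) (p q : nat -> {poly R}).

Lemma nodeS i : node i.+1 = node i + dx.
Proof. by rewrite /Defs.node -natr1; ring. Qed.

Lemma node_le i j : (i <= j)%N -> node i <= node j.
Proof. by move=> ij; rewrite lerD2l ler_wpM2r ?ler_nat ?ltW. Qed.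

Lemma node_ltS i : node i < node i.+1.
Proof. by rewrite nodeS ltrDl. Qed.

Lemma cell_Omega i x : (i < N)%N -> node i <= x <= node i.+1 -> Omega x.
Proof.
move=> iN /andP[ix xi]; rewrite /Defs.Omega/= in_itv/=.
by rewrite (le_trans (node_le (leq0n i)) ix) (le_trans xi (node_le iN)).
Qed.

(** Only open cells are considered, so that one notion covers both spaces and
    also derivatives, which may fail to exist at the nodes. *)
Definition pieces f p := forall i, (i < N)%N ->
  forall x, x \in `]node i, node i.+1[ -> f x = (p i).[x].

Definition cint (i : nat) : {poly R} -> R := pint (node i) (node i.+1).

HB.instance Definition _ i :=
  GRing.isLinear.Build R {poly R} R *%R (cint i) (pint_is_linear _ _).

Lemma cint_deriv i (p : {poly R}) : cint i p^`() = p.[node i.+1] - p.[node i].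
Proof. exact: pint_deriv. Qed.

Lemma cint_ge0 i (p : {poly R}) :
  (forall x, node i < x < node i.+1 -> 0 <= p.[x]) -> 0 <= cint i p.
Proof. exact/pint_ge0/ltW/node_ltS. Qed.

Lemma cint_eq0 i (p : {poly R}) :
    (forall x, node i < x < node i.+1 -> 0 <= p.[x]) ->
  cint i p = 0 -> p = 0.
Proof. exact/pint_eq0/node_ltS. Qed.

Lemma cint_polyC i c : cint i c%:P = c * dx.
Proof.
have -> : c%:P = (c *: 'X)^`() by rewrite derivZ derivX alg_polyC.
by rewrite cint_deriv !hornerE nodeS; ring.
Qed.

(** Induction over the half-open cells. Measurability is carried along because
    f is arbitrary at the nodes. *)
Lemma pieces_integral f p : pieces f p ->
  \int[@lebesgue_measure R]_(x in Omega) f x = \sum_(i < N) cint i (p i).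
Proof.
move=> fp; pose mu := @lebesgue_measure R.
suff H n : (n <= N)%N -> measurable_fun `[node 0, node n[ f /\
    (\int[mu]_(x in `[node 0, node n[) (f x)%:E
     = (\sum_(i < n) cint i (p i))%:E)%E.
  have [mf If] := H N (leqnn N).
  rewrite /Rintegral /Defs.Omega -integral_itv_bndo_bndc ?If//.
  exact/measurable_EFinP.
elim: n => [_|n IH nN].
  rewrite set_itvco0 integral_set0 big_ord0.
  by split=> //; exact: measurable_fun_set0.
have [mf If] := IH (ltnW nN).
have [mc Ic] := integral_poly_itv (node_ltS n) (fp n nN).
have split_itv : `[node 0, node n.+1[%classic =
    `[node 0, node n[%classic `|` `[node n, node n.+1[%classic.
  by apply: itv_bndbnd_setU; rewrite bnd_simp ?node_le ?ltW ?node_ltS.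
have mfc : measurable_fun (`[node 0, node n[ `|` `[node n, node n.+1[) f.
  by apply/measurable_funU => //.
rewrite split_itv; split => //.
rewrite integral_setU//.
- by rewrite If [X in (_ + X)%E]Ic big_ord_recr.
- exact/measurable_EFinP.
- apply/disj_setPS => x [/=]; rewrite !in_itv/= => /andP[_ xn] /andP[nx _].
  by move: (lt_le_trans xn nx); rewrite ltxx.
Qed.

Lemma piecesM f g p q :
  pieces f p -> pieces g q -> pieces (fun x => f x * g x) (fun i => p i * q i).
Proof. by move=> fp gq i iN x xi; rewrite hornerM (fp i) ?(gq i). Qed.

Lemma pieces_derive f p : pieces f p -> pieces (derive1 f) (fun i => (p i)^`()).
Proof.
move=> fp i iN x xi; rewrite derivE !derive1E; apply: near_eq_derive.
have : \forall y \near x, y \in `]node i, node i.+1[ by apply: near_in_itvoo.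
by apply: filterS => y /fp ->.
Qed.

Lemma pieces_lin n (e : 'I_n -> R -> R) (P : 'I_n -> nat -> {poly R})
    (c : 'rV[R]_n) : (forall j, pieces (e j) (P j)) ->
  pieces (fun x => \sum_(j < n) c ord0 j * e j x)
         (fun i => \sum_(j < n) c ord0 j *: P j i).
Proof.
move=> eP i iN x xi; rewrite horner_sum; apply: eq_bigr => j _.
by rewrite hornerZ (eP j i).
Qed.

(** Cell polynomials are determined by the almost everywhere class, through
    continuity; conversely the nodes form a countable set. *)
Lemma ae_eq_piecesP f g p q : pieces f p -> pieces g q ->
  ae_eq_on_Omega a dx N f g <-> (forall i, (i < N)%N -> p i = q i).
Proof.
move=> fp gq; split=> [fg i iN|pq].
  apply/subr0_eq/(poly_itv0 (node_ltS i)) => x xi; rewrite hornerD hornerN.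
  apply/eqP; rewrite subr_eq0; apply/eqP.
  apply: (ae_eq_poly_cont (node_ltS i)).
  - by apply: subset_itv_oo_cc; rewrite /= in_itv.
  - apply: filterS fg => y fgy yi; rewrite -(fp i)// -?(gq i) ?in_itv// fgy//.
    by apply: (cell_Omega iN); move: yi => /andP[/ltW -> /ltW ->].
  - exact: continuous_horner.
have node_countable : countable (range node).
  exact: sub_countable (card_image_le _ _) (countableP _).
exists (range node); split.
- exact: countable_measurable.
- exact: countable_lebesgue_measure0.
move=> x /= nfg; apply: contrapT => xnode; apply: nfg => Ox.
suff [i iN xi] : exists2 i, (i < N)%N & x \in `]node i, node i.+1[.
  by rewrite (fp i)// (gq i)// pq.
have H n : node 0 < x -> x < node n ->
    exists2 i, (i < n)%N & x \in `]node i, node i.+1[.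
  move=> x0; elim: n => [/(lt_trans x0)|n IH xn]; first by rewrite ltxx.
  have [/IH[i iN xi]|nx|xn'] := ltgtP x (node n).
  - by exists i => //; exact: ltnW.
  - by exists n => //; rewrite in_itv/= nx.
  - by case: xnode; exists n.
move: Ox; rewrite /Defs.Omega/= in_itv/= !le_eqVlt.
move=> /andP[/predU1P[x0|x0]]; first by case: xnode; exists 0%N.
by move=> /predU1P[xN|/(H _ x0)//]; case: xnode; exists N.
Qed.

Lemma Dx_pieces z f p q : pieces z p -> pieces f q ->
  Dx a dx N z f = \sum_(i < N) cint i (idfun (q i) * p i).
Proof. by move=> zp fq; rewrite /Dx (pieces_integral (piecesM fq zp)). Qed.

Lemma Dxx_pieces z f p q : pieces z p -> pieces f q ->
  Dxx a dx N z f = \sum_(i < N) cint i ((q i)^`() * p i).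
Proof.
move=> zp fq.
by rewrite /Dxx (pieces_integral (piecesM (pieces_derive fq) zp)).
Qed.

Definition degree_lt K p := forall i, (i < N)%N -> (size (p i) <= K)%N.

(** The families of cell polynomials of the elements of [V0 a dx N K]: see
    [V0_pieces] and [conforming_V0]. *)
Definition conforming K q :=
  [/\ degree_lt K.+1 q,
      forall i, (i.+1 < N)%N -> (q i).[node i.+1] = (q i.+1).[node i.+1],
      (q 0%N).[node 0] = 0 &
      (q N.-1).[node N] = 0].

(** The cell polynomials are gathered in one family by choice; indices beyond
    the last cell get the junk value 0. *)
Lemma Vb_pieces K f : Vb a dx N K f <-> exists2 p, degree_lt K p & pieces f p.
Proof.
split=> [Vf|[p dp fp] i iN]; last first.
  by exists (p i); [exact: dp|exact: fp].
have /choice[p Hp] : forall i, exists p : {poly R}, (i < N)%N ->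
    (size p <= K)%N /\ forall x, x \in `]node i, node i.+1[ -> f x = p.[x].
  move=> i; case: (ltnP i N) => [iN|_]; last by exists 0.
  by have [p sp fp] := Vf i iN; exists p.
by exists p => i iN; have [] := Hp i iN.
Qed.

Hypothesis N_gt0 : (0 < N)%N.

Lemma V0_pieces K f : V0 a dx N K f -> exists2 q, conforming K q & pieces f q.
Proof.
move=> [_ Vf f0 fN].
have /choice[q Hq] : forall i, exists p : {poly R}, (i < N)%N ->
    (size p <= K.+1)%N /\ forall x, x \in `[node i, node i.+1] -> f x = p.[x].
  move=> i; case: (ltnP i N) => [iN|_]; last by exists 0.
  by have [p sp fp] := Vf i iN; exists p.
have fl i : (i < N)%N -> (q i).[node i] = f (node i).
  by move=> iN; rewrite (Hq i iN).2// in_itv/= lexx ltW ?node_ltS.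
have fr i : (i < N)%N -> (q i).[node i.+1] = f (node i.+1).
  by move=> iN; rewrite (Hq i iN).2// in_itv/= lexx ltW ?node_ltS.
exists q; last first.
  by move=> i iN x xi; rewrite (Hq i iN).2//; exact: subset_itv_oo_cc.
split.
- by move=> i iN; have [] := Hq i iN.
- by move=> i iN; rewrite fl// fr// ltnW.
- by rewrite fl.
- by rewrite -[in node N](prednK N_gt0) fr ?prednK.
Qed.

(** A node belongs to the cell on its left, which is immaterial as soon as the
    cell polynomials match there. *)
Fixpoint glue q n x : R :=
  if n is m.+1 then if x <= node m.+1 then glue q m x else (q m.+1).[x]
  else (q 0%N).[x].

Lemma glueE q n i x :
    (forall j, (j < n)%N -> (q j).[node j.+1] = (q j.+1).[node j.+1]) ->
  (i <= n)%N -> node i <= x <= node i.+1 -> glue q n x = (q i).[x].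
Proof.
elim: n i x => [|n IH] i x qn; first by case: i.
have IH' i' x' := IH i' x' (fun j jn => qn j (ltnW jn)).
rewrite leq_eqVlt => /predU1P[-> /andP[nx xn]|iN /andP[ix xi]] /=; last first.
  by rewrite (le_trans xi (node_le iN)) (IH' i)// ix.
case: ifP => // xn'; have -> : x = node n.+1 by apply/eqP; rewrite eq_le xn' nx.
by rewrite (IH' n _) ?qn// lexx ltW ?node_ltS.
Qed.

(** Pasting lemma, applied to one closed cell after another. *)
Lemma within_cells_continuous f q :
    (forall i, (i < N)%N -> forall x, x \in `[node i, node i.+1] ->
       f x = (q i).[x]) ->
  {within Omega, continuous f}.
Proof.
move=> fq.
suff H n : (n <= N)%N -> {within `[node 0, node n], continuous f} by exact: H.
elim: n => [_|n IH nN].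
  by rewrite set_itv1; exact: continuous_subspace1.
rewrite (@itv_bndbnd_setU _ _ _ (BRight (node n))) ?bnd_simp ?node_le//.
(* Pasting needs closed sets, so the last cell is closed on the left. *)
have -> : (`[node 0, node n] `|` `]node n, node n.+1] =
           `[node 0, node n] `|` `[node n, node n.+1])%classic.
  rewrite -[`[node n, node n.+1]%classic](setU1itv false) ?bnd_simp ?node_le//.
  rewrite setUA; congr (_ `|` _); apply/esym/setUidl => x -> /=.
  by rewrite in_itv/= lexx node_le.
apply: withinU_continuous; [exact: itv_closed..|exact/IH/ltnW|].
apply: (@subspace_eq_continuous _ _ _ (horner (q n))).
  by move=> x; rewrite inE => /(fq n nN) fx; exact/esym/fx.
exact/continuous_subspaceT/continuous_horner.
Qed.

(** Every conforming family is available as a test function. *)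
Lemma conforming_V0 K q : conforming K q ->
  exists2 f, V0 a dx N K f & pieces f q.
Proof.
move=> [dq qS q0 qN].
have gE i : (i < N)%N -> forall x, x \in `[node i, node i.+1] ->
    glue q N.-1 x = (q i).[x].
  move=> iN x; rewrite in_itv/= => xi; apply: glueE => //.
    by move=> j; rewrite -ltnS prednK//; exact: qS.
  by rewrite -ltnS prednK.
exists (glue q N.-1); last first.
  by move=> i iN x xi; apply: gE => //; exact: subset_itv_oo_cc.
split.
- exact: within_cells_continuous gE.
- by move=> i iN; exists (q i); [exact: dq|exact: gE].
- by rewrite (gE 0%N)// in_itv/= lexx ltW ?node_ltS.
- rewrite (gE N.-1) ?prednK// in_itv/= lexx andbT.
  by rewrite -[in leRHS](prednK N_gt0) ltW ?node_ltS.
Qed.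

End Pieces.

(** * From matrices to annihilators *)

Section Kernels.
Variables (R : realType) (a dx : R) (N K : nat).
Hypotheses (dx_gt0 : 0 < dx) (N_gt0 : (0 < N)%N) (K_gt0 : (0 < K)%N).
Local Notation node := (node a dx).
Local Notation cint := (cint a dx).
Local Notation pieces := (pieces a dx N).
Local Notation conforming := (conforming a dx N K).
Implicit Types (f g z : R -> R) (p q : nat -> {poly R}).

(* The operator A is the identity for the mass pairing and the derivative for
   the other one. *)
Section AnnihilatorOfConforming.
Variable A : {linear {poly R} -> {poly R}}.

Definition annihilates p :=
  forall q, conforming q -> \sum_(i < N) cint i (A (q i) * p i) = 0.

Lemma annihilates_lin c d p r : annihilates p -> annihilates r ->
  annihilates (fun i => c *: p i + d *: r i).
Proof.
move=> p0 r0 q cq.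
under eq_bigr do rewrite mulrDr -!scalerAr linearD !linearZ/=.
by rewrite big_split/= -!mulr_sumr p0// r0// !mulr0 addr0.
Qed.

Lemma annihilates_eq p r : (forall i, (i < N)%N -> p i = r i) ->
  annihilates p -> annihilates r.
Proof.
move=> pr p0 q cq; rewrite -[RHS](p0 q cq).
by apply: eq_bigr => i _; rewrite pr.
Qed.

Variable D : (R -> R) -> (R -> R) -> R.
Hypothesis D_pieces : forall z f p q, pieces z p -> pieces f q ->
  D z f = \sum_(i < N) cint i (A (q i) * p i).

(** The reduction to polynomials: test functions and conforming families
    correspond to each other. *)
Lemma opker_pieces z p : degree_lt N K p -> pieces z p ->
  opker a dx N K D z <-> annihilates p.
Proof.
move=> dp zp; split=> [[_ z0] q /(conforming_V0 dx_gt0 N_gt0)[f Vf fq]|p0].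
  by rewrite -(D_pieces zp fq) z0.
split; first by apply/Vb_pieces; exists p.
move=> f /(V0_pieces dx_gt0 N_gt0)[q cq fq].
by rewrite (D_pieces zp fq) p0.
Qed.

Lemma opker_ae z f : ae_eq_on_Omega a dx N z f -> Vb a dx N K f ->
  opker a dx N K D z -> opker a dx N K D f.
Proof.
move=> zf /Vb_pieces[q dq fq] kz; have [/Vb_pieces[p dp zp] _] := kz.
move/(opker_pieces dp zp): kz => kp.
apply/(opker_pieces dq fq)/annihilates_eq/kp.
exact/(ae_eq_piecesP dx_gt0 zp fq).
Qed.

Section MatrixKernel.
Variables (n m : nat) (psi : 'I_n -> R -> R) (phi : 'I_m -> R -> R).
Hypothesis psi_basis : is_basis (ae_eq_on_Omega a dx N) (Vb a dx N K) psi.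
Hypothesis phi_basis : is_basis (eq_on_Omega a dx N) (V0 a dx N K) phi.
Local Notation M := (opmx D psi phi).

Definition lin_comb (c : 'rV[R]_n) : R -> R :=
  fun x => \sum_(j < n) c ord0 j * psi j x.

Lemma lin_comb_Vb c : Vb a dx N K (lin_comb c).
Proof.
have /choice[P HP] j : exists p, degree_lt N K p /\ pieces (psi j) p.
  by have /Vb_pieces[p] := psi_basis.1 j; exists p.
apply/Vb_pieces; eexists; last by apply: pieces_lin => j; exact: (HP j).2.
move=> i iN; apply: (leq_trans (size_sum _ _ _)); apply/bigmax_leqP => j _.
exact: leq_trans (size_scale_leq _ _) ((HP j).1 i iN).
Qed.

Lemma lin_comb_inj c d :
  ae_eq_on_Omega a dx N (lin_comb c) (lin_comb d) -> c = d.
Proof.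
move=> cd; have [e [_ e_uniq]] := psi_basis.2 _ (lin_comb_Vb c).
rewrite -(e_uniq d)//; apply/esym/e_uniq; exact: ae_eq_refl.
Qed.

(** The entries of [c *m M] are the pairings of the combination with the test
    basis, and the pairing is linear in the test function. The latter is read
    off the cell polynomials, since derivatives at the nodes need not add up. *)
Lemma kermx_opker (c : 'rV[R]_n) :
  c *m M = 0 <-> opker a dx N K D (lin_comb c).
Proof.
have /choice[P HP] j : exists p, pieces (psi j) p.
  by have /Vb_pieces[p] := psi_basis.1 j; exists p.
have /choice[Q HQ] i : exists q, pieces (phi i) q.
  by have /(V0_pieces dx_gt0 N_gt0)[q] := phi_basis.1 i; exists q.
have combP := pieces_lin c HP.
have cME i : (c *m M) ord0 i = D (lin_comb c) (phi i).
  rewrite (D_pieces combP (HQ i)) mxE.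
  under eq_bigr do rewrite mxE (D_pieces (HP _) (HQ i)) mulr_sumr.
  rewrite exchange_big/=; apply: eq_bigr => k _.
  rewrite mulr_sumr linear_sum; apply: eq_bigr => j _.
  by rewrite -scalerAr linearZ.
split=> [cM0|[_ c0]]; last first.
  by apply/rowP => i; rewrite cME mxE c0//; exact: phi_basis.1.
split; first exact: lin_comb_Vb.
move=> f /phi_basis.2[d [fd _]].
have fQ : pieces f (fun k => \sum_(i < m) d ord0 i *: Q i k).
  move=> k kN x xk; rewrite fd; first exact: (pieces_lin d HQ).
  apply: (cell_Omega dx_gt0 kN); move: xk.
  by rewrite in_itv/= => /andP[/ltW-> /ltW->].
rewrite (D_pieces combP fQ).
under eq_bigr do rewrite linear_sum mulr_suml linear_sum.
rewrite exchange_big/= big1// => i _.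
under eq_bigr do rewrite linearZ -scalerAl linearZ/=.
by rewrite -mulr_sumr -(D_pieces combP (HQ i)) -cME cM0 mxE mulr0.
Qed.

(** The coordinates of a generator span the row space of the kernel. *)
Lemma generated_rank1 z : generated_by a dx N (opker a dx N K D) z ->
  ~ ae_eq_on_Omega a dx N z (fun=> 0) -> \rank (kermx M) = 1%N.
Proof.
move=> [kz gz] zN0; have [c0 [zc0 _]] := psi_basis.2 _ kz.1.
have kc0 : opker a dx N K D (lin_comb c0) := opker_ae zc0 (lin_comb_Vb c0) kz.
have c0N0 : c0 != 0.
  apply/eqP => c00; apply: zN0; apply: ae_eq_trans zc0 _; apply: aeW => x _.
  by rewrite c00 big1// => j _; rewrite mxE mul0r.
suff -> : \rank (kermx M) = \rank c0 by rewrite rank_rV c0N0.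
apply/eqP; rewrite eqn_leq; apply/andP; split; apply: mxrankS; last first.
  exact/sub_kermxP/kermx_opker.
apply/row_subP => i; have /kermx_opker/gz[k kE] : row i (kermx M) *m M = 0.
  by rewrite -row_mul mulmx_ker row0.
rewrite (_ : row i _ = k *: c0) ?scalemx_sub//; apply: lin_comb_inj.
apply: ae_eq_trans kE _; apply: filterS zc0 => x + Ox => /(_ Ox) zx.
by rewrite zx mulr_sumr; apply: eq_bigr => j _; rewrite mxE mulrA.
Qed.

(** Fewer test functions than unknowns leave a nonzero kernel row. *)
Lemma opker_neq0 : (m < n)%N ->
  exists2 z, opker a dx N K D z & ~ ae_eq_on_Omega a dx N z (fun=> 0).
Proof.
move=> mn; have : kermx M != 0.
  rewrite -mxrank_eq0 mxrank_ker -lt0n subn_gt0.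
  exact: leq_ltn_trans (rank_leq_col _) mn.
move=> /rowV0Pn[c /sub_kermxP/kermx_opker kc /eqP cN0].
exists (lin_comb c) => // c0; apply: cN0; apply: lin_comb_inj.
apply: ae_eq_trans c0 _; apply: aeW => x _.
by rewrite /lin_comb big1// => j _; rewrite mxE mul0r.
Qed.

End MatrixKernel.
End AnnihilatorOfConforming.

(** * The kernel of the derivative pairing *)

(** The integral of the derivative of a test function telescopes between the
    two ends, where the test function vanishes. *)
Lemma annihilates_deriv_cst c : annihilates (@deriv R) (fun=> c%:P).
Proof.
move=> q [_ qS q0 qN].
(* The nodal values, equal to the one-sided traces because q is conforming. *)
pose v i := if i is j.+1 then (q j).[node i] else 0.
transitivity (\sum_(0 <= i < N) c * (v i.+1 - v i)).
  rewrite big_mkord; apply: eq_bigr => i _.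
  rewrite mulrC -alg_polyC -scalerAl mul1r linearZ/= cint_deriv.
  by case: i => -[|i] iN/=; rewrite ?q0// -qS.
rewrite -mulr_sumr telescope_sumr//= subr0.
by case: N N_gt0 qN => // N' _ /= ->; rewrite mulr0.
Qed.

(** Test with the primitive q of p - c, c being the mean value; it is conforming
    because its total increment is 0. *)
Lemma annihilates_deriv_eq_cst p : degree_lt N K p ->
  annihilates (@deriv R) p -> exists c, forall i, (i < N)%N -> p i = c%:P.
Proof.
move=> dp p0.
pose S := \sum_(i < N) cint i (p i).
pose c := S / (N%:R * dx); exists c.
pose d i := p i - c%:P.
(* The integral of p - c from the left end to the i-th node. *)
pose s i := \sum_(0 <= j < i) cint j (d j).
have sN : s N = 0.
  have -> : s N = S - N%:R * (c * dx).
    rewrite /s big_mkord mulr_natl -[N in _ *+ N]card_ord -sumr_const -sumrB.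
    by apply: eq_bigr => i _; rewrite linearB/= cint_polyC.
  by rewrite /c; field; rewrite pnatr_eq0 -lt0n N_gt0 gt_eqF.
pose q i := antideriv (d i) + (s i - (antideriv (d i)).[node i])%:P.
have ql i : (q i).[node i] = s i.
  by rewrite hornerD hornerC addrCA subrr addr0.
have qr i : (q i).[node i.+1] = s i.+1.
  by rewrite hornerD hornerC /s big_nat_recr//= addrCA.
have cq : conforming q.
  split.
  - move=> i iN; apply: leq_trans (size_polyD _ _) _; rewrite geq_max.
    rewrite (leq_trans (size_polyC_leq1 _))// andbT.
    apply: leq_trans (size_antideriv _) _; rewrite ltnS.
    apply: leq_trans (size_polyD _ _) _; rewrite geq_max dp// size_polyN.
    exact: leq_trans (size_polyC_leq1 _) K_gt0.
  - by move=> i _; rewrite ql qr.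
  - by rewrite ql /s big_geq.
  - by rewrite -[in node N](prednK N_gt0) qr prednK.
have q' i : (q i)^`() = d i by rewrite derivD derivC addr0 deriv_antideriv.
have dd i : forall x, node i < x < node i.+1 -> 0 <= (d i * d i).[x].
  by move=> x _; rewrite hornerM -expr2 sqr_ge0.
(* As q' = p - c, the pairing of q with p - c is the sum of squares below. *)
have : \sum_(i < N) cint i (d i * d i) = 0.
  transitivity (\sum_(i < N) cint i ((q i)^`() * p i)
                - \sum_(i < N) cint i ((q i)^`() * c%:P)).
    rewrite -sumrB; apply: eq_bigr => i _.
    by rewrite -linearB -mulrBr q'.
  by rewrite p0// annihilates_deriv_cst// subr0.
move/psumr_eq0P => H i iN.
apply/subr0_eq/eqP; rewrite -[_ == 0]orbb -mulf_eq0; apply/eqP.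
apply: (cint_eq0 dx_gt0 (dd i)).
by apply: (H _ (Ordinal iN)) => // j _; apply: (cint_ge0 dx_gt0); exact: dd.
Qed.

(** * The kernel of the mass pairing *)

(** A sum of nonnegative integrals that vanishes has zero integrands. All
    properties of this kernel come from this test with well-chosen q. *)
Lemma annihilates_psd p q : annihilates idfun p -> conforming q ->
    (forall i, (i < N)%N -> forall x, node i < x < node i.+1 ->
       0 <= (q i * p i).[x]) ->
  forall i, (i < N)%N -> q i * p i = 0.
Proof.
move=> p0 /p0/psumr_eq0P H qp i iN.
apply: (cint_eq0 dx_gt0 (qp i iN)).
by apply: (H _ (Ordinal iN)) => // j _; apply: (cint_ge0 dx_gt0); exact: qp.
Qed.

(** Up to the factor dx, the hat function of the interior node j + 1, 
    multiplied by u on its left cell and by v on its right cell. *)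
Definition hat j (u v : {poly R}) (i : nat) : {poly R} :=
  if i == j then ('X - (node j)%:P) * u
  else if i == j.+1 then ((node j.+2)%:P - 'X) * v
  else 0.

Lemma size_mul_affine (r u : {poly R}) : (size r <= 2)%N ->
  (size u <= K)%N -> (size (r * u)%R <= K.+1)%N.
Proof. by move=> sr su; have := size_polyMleq r u; lia. Qed.

Lemma size_XsubC_le c : (size ('X - c%:P : {poly R})%R <= 2)%N.
Proof. by rewrite size_XsubC. Qed.

Lemma size_CsubX_le c : (size (c%:P - 'X : {poly R})%R <= 2)%N.
Proof. by rewrite -opprB size_polyN size_XsubC. Qed.

Lemma hat_conforming j (u v : {poly R}) : (j.+1 < N)%N ->
    (size u <= K)%N -> (size v <= K)%N -> u.[node j.+1] = v.[node j.+1] ->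
  conforming (hat j u v).
Proof.
move=> jN su sv uv; split.
- move=> i iN; rewrite /hat; case: ifP => _; last case: ifP => _.
  + exact: size_mul_affine (size_XsubC_le _) su.
  + exact: size_mul_affine (size_CsubX_le _) sv.
  + by rewrite size_poly0.
- move=> i iN; rewrite /hat eqSS.
  have [->|ij] := eqVneq i j.
    have -> : (j.+1 == j) = false by lia.
    by rewrite !hornerE uv !nodeS; ring.
  have [->|ij1] := eqVneq i j.+1.
    have -> : (j.+2 == j) = false by lia.
    by rewrite !hornerE subrr mul0r.
  by case: eqVneq => [<-|_]; rewrite !hornerE// subrr mul0r.
- by rewrite /hat; case: eqVneq => [<-|_]; rewrite /= !hornerE// subrr mul0r.
- have -> : node N = node N.-1.+1 by rewrite prednK.
  rewrite /hat; have -> : (N.-1 == j) = false by lia.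
  by case: eqVneq => [->|_]; rewrite !hornerE// subrr mul0r.
Qed.

Lemma XsubC_cell_ge0 i x : node i < x < node i.+1 ->
  0 <= ('X - (node i)%:P).[x].
Proof. by move=> /andP[/ltW ix _]; rewrite !hornerE subr_ge0. Qed.

Lemma CsubX_cell_ge0 i x : node i < x < node i.+1 ->
  0 <= ((node i.+1)%:P - 'X).[x].
Proof. by move=> /andP[_ /ltW ix]; rewrite !hornerE subr_ge0. Qed.

Lemma XsubC_mul_eq0 c (r : {poly R}) : ('X - c%:P) * r = 0 -> r = 0.
Proof. by move/eqP; rewrite mulf_eq0 polyXsubC_eq0 => /eqP. Qed.

Lemma CsubX_mul_eq0 c (r : {poly R}) : (c%:P - 'X) * r = 0 -> r = 0.
Proof. by move/eqP; rewrite -opprB mulNr oppr_eq0 => /eqP/XsubC_mul_eq0. Qed.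

(** The hat function is positive inside its two cells, so only the signs of
    u p_j and v p_{j+1} matter. *)
Lemma annihilates_hat p j (u v : {poly R}) :
    annihilates idfun p -> (j.+1 < N)%N -> (size u <= K)%N -> (size v <= K)%N ->
    u.[node j.+1] = v.[node j.+1] ->
    (forall x, 0 <= (u * p j).[x]) -> (forall x, 0 <= (v * p j.+1).[x]) ->
  u * p j = 0 /\ v * p j.+1 = 0.
Proof.
move=> p0 jN su sv uv up vp.
have hat_mul i : hat j u v i * p i =
    if i == j then ('X - (node j)%:P) * (u * p j)
    else if i == j.+1 then ((node j.+2)%:P - 'X) * (v * p j.+1) else 0.
  rewrite /hat; case: eqVneq => [->|_]; first by rewrite mulrA.
  by case: eqVneq => [->|_]; rewrite ?mulrA ?mul0r.
have hp0 : forall i, (i < N)%N -> hat j u v i * p i = 0.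
  apply: annihilates_psd p0 (hat_conforming jN su sv uv) _ => i iN x xi.
  rewrite hat_mul; case: eqVneq => [ij|_].
    by rewrite hornerM mulr_ge0// XsubC_cell_ge0// -ij.
  case: eqVneq => [ij|_]; last by rewrite horner0.
  by rewrite hornerM mulr_ge0// CsubX_cell_ge0// -ij.
split.
- by have := hp0 j (ltnW jN); rewrite hat_mul eqxx => /XsubC_mul_eq0.
- have := hp0 j.+1 jN; rewrite hat_mul gtn_eqF// eqxx.
  exact: CsubX_mul_eq0.
Qed.

Lemma sqr_poly_ge0 (r : {poly R}) x : 0 <= (r * r).[x].
Proof. by rewrite hornerM -expr2 sqr_ge0. Qed.

Lemma sqr_poly_eq0 (r : {poly R}) : r * r = 0 -> r = 0.
Proof. by move/eqP; rewrite mulf_eq0 orbb => /eqP. Qed.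

Lemma size_polyC_leK c : (size (c%:P : {poly R}) <= K)%N.
Proof. exact: leq_trans (size_polyC_leq1 _) K_gt0. Qed.

Section KernelOfMass.
Variable p : nat -> {poly R}.
Hypotheses (deg_p : degree_lt N K p) (p_orth : annihilates idfun p).

(** Test with u = p_j and v = p_{j+1}: continuity at the node is exactly the
    matching condition, and both products are squares. *)
Lemma continuous_interface_eq0 j : (j.+1 < N)%N ->
  (p j).[node j.+1] = (p j.+1).[node j.+1] -> p j = 0.
Proof.
move=> jN pj; have [||||] := annihilates_hat p_orth jN _ _ pj.
- exact/deg_p/ltnW.
- exact: deg_p.
- exact: sqr_poly_ge0.
- exact: sqr_poly_ge0.
by move=> /sqr_poly_eq0.
Qed.

(** On the cell where p vanishes the test function is irrelevant, so a constant
    factor there can match any trace of the other polynomial. *)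
Lemma zero_propagates j : (j.+1 < N)%N -> p j = 0 <-> p j.+1 = 0.
Proof.
move=> jN; split=> pj0.
- pose u := ((p j.+1).[node j.+1])%:P.
  have [|||||] := @annihilates_hat p j u (p j.+1) p_orth jN.
  + exact: size_polyC_leK.
  + exact: deg_p.
  + by rewrite hornerC.
  + by move=> x; rewrite pj0 mulr0 horner0.
  + exact: sqr_poly_ge0.
  by move=> _ /sqr_poly_eq0.
- pose v := ((p j).[node j.+1])%:P.
  have [|||||] := @annihilates_hat p j (p j) v p_orth jN.
  + exact/deg_p/ltnW.
  + exact: size_polyC_leK.
  + by rewrite hornerC.
  + exact: sqr_poly_ge0.
  + by move=> x; rewrite pj0 mulr0 horner0.
  by move=> /sqr_poly_eq0.
Qed.

Lemma zero_cell_eq0 j : (j < N)%N -> p j = 0 -> forall i, (i < N)%N -> p i = 0.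
Proof.
have H i : (i < N)%N -> p 0%N = 0 <-> p i = 0.
  elim: i => // i IH iN; rewrite -(zero_propagates iN); exact/IH/ltnW.
by move=> jN /(H j jN) p00 i iN; apply/(H i iN).
Qed.

(** With zero left trace, p times the decreasing half-hat on the first cell is
    conforming; the resulting product is a nonnegative multiple of a square. *)
Lemma zero_left_end_eq0 : (p 0%N).[node 0] = 0 ->
  forall i, (i < N)%N -> p i = 0.
Proof.
move=> pl; apply: (@zero_cell_eq0 0) => //.
pose q i : {poly R} := if i is 0%N then ((node 1)%:P - 'X) * p 0%N else 0.
have cq : conforming q.
  split.
  - case=> [_|i iN]; last by rewrite size_poly0.
    exact: size_mul_affine (size_CsubX_le _) (deg_p N_gt0).
  - by case=> [|i] iN; rewrite !hornerE// subrr mul0r.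
  - by rewrite hornerM pl mulr0.
  - case: N N_gt0 => // -[|N'] _ /=; last by rewrite horner0.
    by rewrite !hornerE subrr mul0r.
apply/sqr_poly_eq0/(@CsubX_mul_eq0 (node 1)); rewrite mulrA.
apply: (annihilates_psd p_orth cq) N_gt0.
case=> [_|i iN] x xi; last by rewrite mul0r horner0.
by rewrite /= -mulrA hornerM mulr_ge0 ?sqr_poly_ge0// CsubX_cell_ge0.
Qed.

End KernelOfMass.

(** * Generators of the kernels *)

Lemma pieces_cst c : pieces (fun=> c) (fun=> c%:P).
Proof. by move=> i iN x _; rewrite hornerC. Qed.

Lemma opker_Dx_nonzero z p : degree_lt N K p -> pieces z p ->
    opker a dx N K (Dx a dx N) z -> ~ ae_eq_on_Omega a dx N z (fun=> 0) ->
  annihilates idfun p /\ forall i, (i < N)%N -> p i <> 0.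
Proof.
move=> dp zp kz zN0; have p0 : annihilates idfun p.
  exact/(opker_pieces (@Dx_pieces R a dx N dx_gt0) dp zp).
split=> // i iN pi0; apply/zN0/(ae_eq_piecesP dx_gt0 zp (pieces_cst 0)) => j jN.
by rewrite (zero_cell_eq0 dp p0 iN pi0).
Qed.

(** The combination of z and w whose left trace is 0 must vanish. *)
Lemma Dx_kernel_generated z : opker a dx N K (Dx a dx N) z ->
    ~ ae_eq_on_Omega a dx N z (fun=> 0) ->
  generated_by a dx N (opker a dx N K (Dx a dx N)) z.
Proof.
move=> kz zN0; have [/Vb_pieces[p dp zp] _] := kz.
have [p0 pN0] := opker_Dx_nonzero dp zp kz zN0.
split=> // w kw; have [/Vb_pieces[r dr wr] _] := kw.
have r0 : annihilates idfun r.
  exact/(opker_pieces (@Dx_pieces R a dx N dx_gt0) dr wr).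
set pl := (p 0%N).[node 0]; set rl := (r 0%N).[node 0].
have plN0 : pl != 0.
  apply/eqP => pl0; apply: (pN0 _ N_gt0).
  exact: (zero_left_end_eq0 dp p0 pl0).
exists (rl / pl).
have zkp : pieces (fun x => rl / pl * z x) (fun i => (rl / pl) *: p i).
  by move=> i iN x xi; rewrite hornerZ (zp i).
apply/(ae_eq_piecesP dx_gt0 wr zkp) => i iN.
(* The coefficient cancels the left traces; [1 *: r i] fits
   [annihilates_lin]. *)
pose y i := 1 *: r i + (- (rl / pl)) *: p i.
suff : y i = 0 by rewrite /y scale1r scaleNr => /subr0_eq.
apply: (@zero_left_end_eq0 y) => //.
- move=> j jN; apply: leq_trans (size_polyD _ _) _.
  by rewrite geq_max !(leq_trans (size_scale_leq _ _)) ?dr ?dp.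
- exact: annihilates_lin.
- by rewrite !hornerE -/pl -/rl; field.
Qed.

(** A continuous representative would have both one-sided traces of z as its
    value, making the cell polynomials match at the node. *)
Lemma Dx_kernel_discontinuous z i : opker a dx N K (Dx a dx N) z ->
    ~ ae_eq_on_Omega a dx N z (fun=> 0) -> (0 < i < N)%N ->
  ae_discontinuous_at a dx N z (node i).
Proof.
case: i => // j kz zN0 /= jN g zg cg; have [/Vb_pieces[p dp zp] _] := kz.
have [p0 pN0] := opker_Dx_nonzero dp zp kz zN0.
have gnode k : (k < N)%N -> node j.+1 \in `[node k, node k.+1] ->
    g (node j.+1) = (p k).[node j.+1].
  move=> kN jk; apply: (ae_eq_poly_cont (node_ltS a dx_gt0 k)) cg => //.
  apply: filterS zg => x zgx xk; rewrite -zgx ?(zp k) ?in_itv//.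
  by apply: (cell_Omega dx_gt0 kN); move: xk => /andP[/ltW-> /ltW->].
apply: (pN0 j (ltnW jN)); apply: (continuous_interface_eq0 dp p0 jN).
have nS k := ltW (node_ltS a dx_gt0 k).
by rewrite -!gnode ?in_itv/= ?lexx ?nS// ltnW.
Qed.

Lemma Dxx_kernel_generated :
  generated_by a dx N (opker a dx N K (Dxx a dx N)) (fun=> 1).
Proof.
split.
  apply/(opker_pieces (@Dxx_pieces R a dx N dx_gt0) _ (pieces_cst 1)).
  - by move=> i _; exact: size_polyC_leK.
  - exact: annihilates_deriv_cst.
move=> w kw; have [/Vb_pieces[p dp wp] _] := kw.
have [c pc] := annihilates_deriv_eq_cst dp
  ((opker_pieces (@Dxx_pieces R a dx N dx_gt0) dp wp).1 kw).
exists c; apply/(ae_eq_piecesP dx_gt0 wp _) => [|i iN]; last exact: pc.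
by move=> i iN x _; rewrite hornerC mulr1.
Qed.

Lemma ae_one_neq0 : ~ ae_eq_on_Omega a dx N (fun=> 1) (fun=> 0 : R).
Proof.
move/(ae_eq_piecesP dx_gt0 (pieces_cst 1) (pieces_cst 0))/(_ _ N_gt0)/eqP.
by rewrite polyC_eq0 oner_eq0.
Qed.

End Kernels.

Theorem proposition5p3 (R : realType) (a dx : R) (N K : nat)
    (hdx : 0 < dx) (hN : (1 <= N)%N) (hK : (1 <= K)%N)
    (psi : 'I_(N * K) -> R -> R) (phi : 'I_(N * K - 1) -> R -> R)
    (hpsi : is_basis (ae_eq_on_Omega a dx N) (Vb a dx N K) psi)
    (hphi : is_basis (eq_on_Omega a dx N) (V0 a dx N K) phi) :
  [/\ \rank (kermx (opmx (Dx a dx N) psi phi)) = 1%N,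
      \rank (kermx (opmx (Dxx a dx N) psi phi)) = 1%N,
      exists z : R -> R,
        generated_by a dx N (opker a dx N K (Dx a dx N)) z /\
        (forall i : nat, (0 < i < N)%N ->
           ae_discontinuous_at a dx N z (node a dx i)) &
      generated_by a dx N (opker a dx N K (Dxx a dx N)) (fun=> 1)].
Proof.
have Dx_form := @Dx_pieces R a dx N hdx.
have Dxx_form := @Dxx_pieces R a dx N hdx.
have rank_def : (N * K - 1 < N * K)%N by rewrite subn1 prednK ?muln_gt0 ?hN.
have [z kz zN0] := opker_neq0 hdx hN Dx_form hpsi hphi rank_def.
have gz := Dx_kernel_generated hdx hN hK kz zN0.
have g1 := Dxx_kernel_generated a hdx hN hK.
split.
- exact: (generated_rank1 hdx hN Dx_form hpsi hphi gz zN0).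
- exact: (generated_rank1 hdx hN Dxx_form hpsi hphi g1 (ae_one_neq0 hdx hN)).
- exists z; split=> // i iN.
  exact: Dx_kernel_discontinuous kz zN0 iN.
- exact: g1.
Qed.
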